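(* Let $(\bar{x},\bar{y})\in X_{\rm LP}$. Suppose that $|T|\ge 2$, that $a_q\le b_1$ for all $q\in Q$, that $b_1r+c<a_q$ for all $q\in Q$, that $\sum_{q\in Q}a_q\le b_t+c$ for all $t\in T\setminus\{1\}$, that $$\sum_{q\in Q}a_q\le b_1(r+1)+c,$$ and that $\sum_{t\in T\setminus\{1\}}\bar{y}_t<1$. Let $\tilde{Q}=\{q\in Q:\bar{x}_q>\sum_{t\in T\setminus\{1\}}\bar{y}_t\}$. Then the following hold. (a) If $\tilde{Q}=\varnothing$, the inequality $0\le y_1+r\sum_{t\in T\setminus\{1\}}y_t-r$ solves the separation problem for $(\bar{x},\bar{y})$. (b) If $\tilde{Q}\ne\varnothing$, the inequality $x_d\le y_1+(r+1)\sum_{t\in T\setminus\{1\}}y_t-r$ solves the separation problem for $(\bar{x},\bar{y})$. Moreover, in both cases, the respective inequality defines a facet of the polyhedron $P$.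
   Context: $Q$ is a finite set, $T=\{1,\ldots,|T|\}\neq\varnothing$, $0<b_1\le\cdots\le b_{|T|}$ are real numbers, $a_q>0$ for all $q\in Q$, $c\in\mathbb{R}$, and $\sum_{q\in Q}a_q-c>0$. The unsplittable flow arc-set is $$X=\Big\{(x,y)\in\{0,1\}^{|Q|}\times\mathbb{Z}_+^{|T|}:\ \sum_{q\in Q}a_qx_q\le\sum_{t\in T}b_ty_t+c\Big\},$$ $P=\mathrm{conv}(X)$, and $X_{\rm LP}=\{(x,y)\in[0,1]^{|Q|}\times\mathbb{R}_+^{|T|}:\sum_{q\in Q}a_qx_q\le\sum_{t\in T}b_ty_t+c\}$. Let $r=\max\{\lceil -c/b_1\rceil,0\}$ and let $d\in\operatorname{argmax}_q\{\bar{x}_q:q\in Q\}$ (used only when $Q\neq\varnothing$). Separation problem for $(\bar{x},\bar{y})$: with $(x^1,y^1),\ldots,(x^u,y^u)$ the vertices of $P$, $$\max_{\alpha,\beta,\gamma}\ \bar{x}^{\top}\alpha-\bar{y}^{\top}\beta-\gamma\quad\text{s.t.}\quad (x^k)^{\top}\alpha-(y^k)^{\top}\beta-\gamma\le 0\ (k=1,\ldots,u),\quad \beta_1=1,\quad \beta_t\ge 0\ (t\in T\setminus\{1\}),$$ over $(\alpha,\beta,\gamma)\in\mathbb{R}^{|Q|}\times\mathbb{R}^{|T|}\times\mathbb{R}$. An inequality $\alpha^{\top}x\le\beta^{\top}y+\gamma$ is said to solve the separation problem if $(\alpha,\beta,\gamma)$ is an optimal solution of this problem. *)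

(* Defs.v *)
From HB Require Import structures.
From mathcomp Require Import all_boot all_order all_algebra.
From mathcomp Require Import classical_sets reals convex.

Set Implicit Arguments.
Unset Strict Implicit.
Unset Printing Implicit Defensive.

Import Order.TTheory GRing.Theory Num.Theory.
Local Open Scope ring_scope.

Section Polyhedra.
Context {R : realType} {E : vectType R}.
Implicit Types A F : set E.

Definition conv_hull A : set E := smallest (@convex_set R E) A.

(* Vertices are taken to be extreme points. *)
Definition vertex A (v : E) : Prop :=
  A v /\ forall (u w : E) (l : R), A u -> A w -> 0 < l < 1 ->
    v = l *: u + (1 - l) *: w -> u = w.

Definition aff_indep (s : seq E) : bool :=
  if s is p :: s' then free [seq x - p | x <- s'] else true.

(* [has_dim A k]: the maximum number of affinely independent points of [A] is
   [k + 1]; in particular [A] is nonempty. *)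
Definition has_dim A (k : nat) : Prop :=
  (exists s : seq E,
     [/\ size s = k.+1, aff_indep s & forall p, p \in s -> A p]) /\
  (forall s : seq E,
     aff_indep s -> (forall p, p \in s -> A p) -> (size s <= k.+1)%N).

End Polyhedra.

(* The nonempty set [T = {1, ..., |T|}] is ['I_n.+1], so |T| = n + 1 and the
   element 1 of T is [ord0]. The entries are in [R^o] so that pairs (x, y) form
   a [vectType R]. *)
Notation flow_space R Q n :=
  ({ffun Q -> R^o} * {ffun 'I_n.+1 -> R^o})%type.

Section UnsplittableFlow.
Context {R : realType} {Q : finType} {n : nat}.

Definition capacity_constraint (a : Q -> R) (b : 'I_n.+1 -> R) (c : R)
    (p : flow_space R Q n) : Prop :=
  \sum_q a q * (p.1 q : R) <= \sum_t b t * (p.2 t : R) + c.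

Definition arc_set (a : Q -> R) (b : 'I_n.+1 -> R) (c : R) :
    set (flow_space R Q n) := fun p =>
  [/\ forall q, (p.1 q : R) = 0 \/ (p.1 q : R) = 1,
      forall t, (p.2 t : R) \is a Num.nat
    & capacity_constraint a b c p].

Definition arc_set_LP (a : Q -> R) (b : 'I_n.+1 -> R) (c : R) :
    set (flow_space R Q n) := fun p =>
  [/\ forall q, 0 <= (p.1 q : R) <= 1,
      forall t, 0 <= (p.2 t : R)
    & capacity_constraint a b c p].

Definition arc_poly (a : Q -> R) (b : 'I_n.+1 -> R) (c : R) :
    set (flow_space R Q n) := conv_hull (arc_set a b c).

(* The triple [(alpha, beta, gamma)] stands for the inequality
   alpha^T x <= beta^T y + gamma; [violation] is the left-hand side minus the
   right-hand side. *)
Definition violation (alpha : Q -> R) (beta : 'I_n.+1 -> R) (gamma : R)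
    (p : flow_space R Q n) : R :=
  \sum_q (p.1 q : R) * alpha q - \sum_t (p.2 t : R) * beta t - gamma.

Definition sep_feasible (P : set (flow_space R Q n))
    (alpha : Q -> R) (beta : 'I_n.+1 -> R) (gamma : R) : Prop :=
  [/\ forall v, vertex P v -> violation alpha beta gamma v <= 0,
      beta ord0 = 1
    & forall t, t != ord0 -> 0 <= beta t].

Definition solves_separation (P : set (flow_space R Q n))
    (pbar : flow_space R Q n)
    (alpha : Q -> R) (beta : 'I_n.+1 -> R) (gamma : R) : Prop :=
  sep_feasible P alpha beta gamma /\
  forall alpha' beta' gamma', sep_feasible P alpha' beta' gamma' ->
    violation alpha' beta' gamma' pbar <= violation alpha beta gamma pbar.

Definition defines_facet (P : set (flow_space R Q n))
    (alpha : Q -> R) (beta : 'I_n.+1 -> R) (gamma : R) : Prop :=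
  (forall p, P p -> \sum_q alpha q * (p.1 q : R)
                    <= \sum_t beta t * (p.2 t : R) + gamma) /\
  exists k : nat,
    has_dim P k.+1 /\
    has_dim (fun p => P p /\ \sum_q alpha q * (p.1 q : R)
                             = \sum_t beta t * (p.2 t : R) + gamma) k.

Definition Q_tilde (pbar : flow_space R Q n) : {set Q} :=
  finset (fun q => \sum_(t | t != ord0) (pbar.2 t : R) < (pbar.1 q : R)).

End UnsplittableFlow.

(* Main.v *)
Require Import Defs.
From HB Require Import structures.
From mathcomp Require Import all_boot all_order all_algebra.
From mathcomp Require Import classical_sets reals convex.
From mathcomp Require Import interval_inference.
From mathcomp Require Import ring lra.

(** Write [z] for the total amount of the [y_t] with [t != ord0], and [rho] for
    the real number [r].  The hypotheses make the arc set nearly trivial: the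
    choice of [r] as the least natural number with [0 <= b_1 r + c] means that a
    point with [z = 0] needs [y_1 >= r]; at [y_1 = r] only [x = 0] fits, while at
    [y_1 = r + 1], or as soon as [z >= 1], every subset of [Q] fits.  Hence both
    inequalities of the statement are valid ([arc_set_lower_bounds]), and
    together with the box constraints they are enough to recognise the vertices
    that matter: [(0, r e_1)], [(S, (r + 1) e_1)] for [S] nonempty, and
    [(S, e_t)] for [t != ord0].

    Optimality is weak duality carried out by hand ([violation_upper_bound]).
    Let [M] be the largest value of [alpha] on a subset of [Q].  Feasibility at
    those vertices gives [gamma >= - r], [M <= r + 1 + gamma] and
    [M <= beta_t + gamma].  If all the [xbar_q] lie below some [u] with
    [z <= u <= 1], then [alpha . xbar <= u M = z M + (u - z) M], and the three
    bounds, weighted by [1 - u], [u - z] and [ybar_t], give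
    [u + r - (ybar_1 + (r + 1) z)] as an upper bound on the objective.  The
    weights are those of a convex combination of such points that differs from
    the given point only in [y_1], whose coefficient is fixed to 1.  The
    inequality of (a) attains the bound for [u = z], which is allowed when
    [Q_tilde] is empty; that of (b) attains it for [u = xbar_d], which exceeds [z]
    when [Q_tilde] is not empty.

    For the facets, each inequality is tight at [|Q| + n + 1] explicit points of
    the arc set and slack at [(0, (r + 1) e_1)].  These points together affinely
    span the whole space, so the polyhedron is full-dimensional and the face has
    codimension one ([facet_dims]). *)

Set Implicit Arguments.
Unset Strict Implicit.
Unset Printing Implicit Defensive.

Import Order.TTheory GRing.Theory Num.Theory.
Local Open Scope ring_scope.

(** * Convex hulls, vertices and facets *)

Section Polyhedra.
Context {R : realType} {E : vectType R}.
Implicit Types (A F P : set E) (f : {linear E -> R^o}) (m : R).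

Lemma conv_hull_le A f m :
  (forall p, A p -> f p <= m) -> forall p, conv_hull A p -> f p <= m.
Proof.
move=> Am; apply: (@smallest_sub _ _ A (fun p => f p <= m)) => // x y l.
rewrite !inE /= => xm ym.
have l0 : 0 <= l%:num by [].
have l1 : l%:num <= 1 by [].
have -> : f (conv l x y) = l%:num * f x + (1 - l%:num) * f y.
  by rewrite (linearD f) !linearZ.
nra.
Qed.

(** A point determined by the linear functionals that it maximises is extreme:
    both ends of a segment through it maximise the same functionals. *)
Lemma vertex_conv_hull A v :
  A v ->
  (forall u, (forall f, (forall w, A w -> f w <= f v) -> f u = f v) -> u = v) ->
  vertex (conv_hull A) v.
Proof.
move=> Av tight_v; split; first exact: sub_gen_smallest.
(* By symmetry in [u] and [w], one endpoint is enough. *)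
suff half u w l : conv_hull A u -> conv_hull A w -> 0 < l < 1 ->
    v = l *: u + (1 - l) *: w -> u = v.
  move=> u w l Pu Pw l01 vE; rewrite (half u w l)// (half w u (1 - l))//.
    by move/andP: l01 => [l0 l1]; apply/andP; split; lra.
  by rewrite vE addrC; congr (_ + _ *: _); ring.
move=> Pu Pw /andP[l0 l1] vE; apply: tight_v => f fv.
have fu := conv_hull_le fv Pu; have fw := conv_hull_le fv Pw.
have fvE : f v = l * f u + (1 - l) * f w.
  by rewrite {1}vE linearD !linearZ.
apply/eqP; rewrite eq_le fu /= leNgt; apply/negP => fuv; nra.
Qed.

Lemma linear_span_eq0 f (s : seq E) v :
  (forall x, x \in s -> f x = 0) -> v \in <<s>>%VS -> f v = 0.
Proof.
move=> fs; rewrite -[s]/(tval (in_tuple s)) => /coord_span ->.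
rewrite linear_sum big1// => i _.
by rewrite linearZ /= fs ?scaler0// mem_nth.
Qed.

Lemma aff_indep_size (s : seq E) : aff_indep s -> (size s <= (dim E).+1)%N.
Proof.
case: s => [//|p s] /= /eqP fs; rewrite ltnS -(size_map (fun x => x - p)) -fs.
by rewrite -dimvf dimvS// subvf.
Qed.

(** One point [e] off the hyperplane plays two roles: added to the points of the
    face it gives the dimension of [P], and added to any affinely independent
    points of the face it keeps them independent, which bounds the dimension of
    the face by that of the space minus one. *)
Lemma facet_dims P F f m k p e (s : seq E) :
  dim E = k.+1 ->
  (forall x, F x <-> P x /\ f x = m) ->
  P e -> f e != m -> F p -> (forall x, x \in s -> F x) ->
  size s = k ->
  (fullv <= << e - p :: [seq x - p | x <- s] >>)%VS ->
  has_dim P k.+1 /\ has_dim F k.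
Proof.
move=> dimE FE Pe fe Fp Fs ss full.
have free_s : free (e - p :: [seq x - p | x <- s]).
  apply: (@basis_free _ _ fullv); rewrite basisEdim full dimvf dimE /=.
  by rewrite size_map ss.
have FP x : F x -> P x by case/FE.
split; split.
- exists [:: p, e & s]; split; [by rewrite /= ss | exact: free_s |].
  by move=> x; rewrite !inE => /or3P[/eqP->|/eqP->|/Fs] //; auto.
- by move=> t /aff_indep_size; rewrite dimE.
- exists (p :: s); split; first by rewrite /= ss.
    by move: free_s; rewrite free_cons => /andP[].
  by move=> x; rewrite inE => /orP[/eqP->|/Fs].
- case=> [//|q t] free_t Ft.
  suff : aff_indep [:: q, e & t] by move/aff_indep_size; rewrite dimE /=.
  rewrite /= free_cons; apply/andP; split => //.
  have /FE[_ fq] : F q by apply: Ft; rewrite mem_head.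
  apply: contra fe => /(@linear_span_eq0 f) fe0.
  rewrite -fq -subr_eq0 -linearB fe0// => x /mapP[y yt ->].
  have /FE[_ fy] : F y by apply: Ft; rewrite inE yt orbT.
  by rewrite linearB /= fy fq subrr.
Qed.

End Polyhedra.

(** * Linear forms and unit points of the flow space *)

Section FlowSpace.
Context {R : realType} {Q : finType} {n : nat}.
Implicit Types (alpha : Q -> R) (beta : 'I_n.+1 -> R) (gamma : R).
Implicit Types (p : flow_space R Q n) (S : {set Q}) (s t : 'I_n.+1) (m : R).

Definition flow_form alpha beta p : R^o :=
  \sum_q (p.1 q : R) * alpha q - \sum_t (p.2 t : R) * beta t.

Lemma flow_form_linear alpha beta : linear (flow_form alpha beta).
Proof.
move=> k p p'; rewrite /flow_form scalerBr !scaler_sumr addrACA -opprD.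
rewrite -!big_split; congr (_ - _); apply: eq_bigr => i _ /=.
  by rewrite !ffunE mulrDl /GRing.scale /= mulrA.
by rewrite !ffunE mulrDl /GRing.scale /= mulrA.
Qed.

HB.instance Definition _ alpha beta :=
  GRing.isLinear.Build R (flow_space R Q n) R^o *:%R (flow_form alpha beta)
    (flow_form_linear alpha beta).

Lemma violationE alpha beta gamma p :
  violation alpha beta gamma p = flow_form alpha beta p - gamma.
Proof. by []. Qed.

Lemma ineq_violation alpha beta gamma p :
  (\sum_q alpha q * (p.1 q : R) <= \sum_t beta t * (p.2 t : R) + gamma) =
  (violation alpha beta gamma p <= 0).
Proof.
rewrite /violation; under eq_bigr do rewrite mulrC.
under [X in _ <= X + _]eq_bigr do rewrite mulrC.
by rewrite -addrA -opprD subr_le0.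
Qed.

Lemma tight_flow_form alpha beta gamma p :
  \sum_q alpha q * (p.1 q : R) = \sum_t beta t * (p.2 t : R) + gamma <->
  flow_form alpha beta p = gamma.
Proof.
rewrite /flow_form; under eq_bigr do rewrite mulrC.
under [X in _ = X + _ <-> _]eq_bigr do rewrite mulrC.
by split => [->|<-]; ring.
Qed.

(** The incidence vector of [S] paired with [m] units at [s] and none elsewhere;
    the vertices and the tight points of the facets all have this form. *)
Definition arc_point S s m : flow_space R Q n :=
  ([ffun q => (q \in S)%:R], [ffun t => if t == s then m else 0]).

Lemma flow_form_arc_point alpha beta S s m :
  flow_form alpha beta (arc_point S s m) = \sum_(q in S) alpha q - m * beta s.
Proof.
rewrite /flow_form /=; congr (_ - _).
  rewrite [RHS]big_mkcond; apply: eq_bigr => q _; rewrite ffunE.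
  by case: ifP; rewrite ?mul1r ?mul0r.
rewrite (bigD1 s)//= ffunE eqxx big1 ?addr0// => t ts.
by rewrite ffunE (negPf ts) mul0r.
Qed.

Lemma arc_point_split S s m :
  arc_point S s m = arc_point S ord0 0 + m *: arc_point finset.set0 s 1.
Proof.
congr (_, _); apply/ffunP => i; rewrite !ffunE ?inE.
  by rewrite scaler0 addr0.
by rewrite if_same add0r; case: ifP; rewrite ?scaler0 // /GRing.scale /= mulr1.
Qed.

Lemma flow_space_span (V : {vspace flow_space R Q n}) :
  (forall q, arc_point [set q] ord0 0 \in V) ->
  (forall t, arc_point finset.set0 t 1 \in V) -> (fullv <= V)%VS.
Proof.
move=> Vx Vy; apply/subvP => v _.
have -> : v = \sum_q v.1 q *: arc_point [set q] ord0 0 +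
              \sum_t v.2 t *: arc_point finset.set0 t 1.
  have fst_sum (I : finType) (F : I -> flow_space R Q n) :
      (\sum_i F i).1 = \sum_i (F i).1 by exact: big_morph.
  have snd_sum (I : finType) (F : I -> flow_space R Q n) :
      (\sum_i F i).2 = \sum_i (F i).2 by exact: big_morph.
  rewrite {1}[v]surjective_pairing; congr (_, _).
    rewrite [RHS]/= !fst_sum [X in _ + X]big1 => [|t _]; last first.
      by apply/ffunP => q; rewrite !ffunE inE scaler0.
    apply/ffunP => q; rewrite addr0 sum_ffunE (bigD1 q)//= !ffunE !inE eqxx.
    rewrite big1 => [|i iq]; first by rewrite addr0 /GRing.scale /= mulr1.
    by rewrite !ffunE inE eq_sym (negPf iq) scaler0.
  rewrite [RHS]/= !snd_sum [X in X + _]big1 => [|q _]; last first.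
    by apply/ffunP => t; rewrite !ffunE if_same scaler0.
  apply/ffunP => t; rewrite add0r sum_ffunE (bigD1 t)//= !ffunE eqxx.
  rewrite big1 => [|i it]; first by rewrite addr0 /GRing.scale /= mulr1.
  by rewrite !ffunE eq_sym (negPf it) scaler0.
by rewrite rpredD// rpred_sum// => i _; rewrite rpredZ.
Qed.

Lemma dim_flow_space : dim (flow_space R Q n) = (#|Q| + n).+1.
Proof.
rewrite /dim /= -[LHS]/(#|Q| * 1 + #|'I_n.+1| * 1)%N.
by rewrite !muln1 card_ord addnS.
Qed.

Lemma flow_form_two_rates alpha k p :
  flow_form alpha (fun t => if t == ord0 then 1 else k) p =
  \sum_q (p.1 q : R) * alpha q
  - ((p.2 ord0 : R) + k * \sum_(t | t != ord0) (p.2 t : R)).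
Proof.
rewrite /flow_form; congr (_ - _).
rewrite (bigD1 ord0)//= mulr1 mulr_sumr; congr (_ + _).
by apply: eq_bigr => t /negPf ->; rewrite mulrC.
Qed.

End FlowSpace.

(** On the box [[0, u]^I] a linear form is largest at [u] times the indicator of
    its positive coefficients. *)
Lemma sum_mul_le_pos_part (R : realDomainType) (I : finType) (x alpha : I -> R)
    (u : R) :
  (forall i, 0 <= x i <= u) ->
  \sum_i x i * alpha i <= u * \sum_(i in [set i | 0 < alpha i]) alpha i.
Proof.
move=> xu; rewrite mulr_sumr [leRHS]big_mkcond.
apply: ler_sum => i _; have /andP[x0 x_le] := xu i; rewrite inE.
have [gt0|le0] := ltrP 0 (alpha i).
  by rewrite ler_pM2r.
exact: mulr_ge0_le0.
Qed.

Lemma natr_lt_addr1 (R : archiNumDomainType) (x y : R) :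
  x \is a Num.nat -> y \is a Num.nat -> x < y -> x + 1 <= y.
Proof. by move=> /natrP[k ->] /natrP[l ->]; rewrite ltr_nat natr1 ler_nat. Qed.

(** * The arc set under the hypotheses on capacities *)

Section ArcPolytope.
Context {R : realType} {Q : finType} {n : nat}.
Context (a : Q -> R) (b : 'I_n.+1 -> R) (c rho : R).
Implicit Types (alpha : Q -> R) (beta : 'I_n.+1 -> R) (gamma : R).
Implicit Types (p : flow_space R Q n) (S : {set Q}) (s t : 'I_n.+1) (m : R).

Let X : set (flow_space R Q n) := arc_set a b c.
Let P := arc_poly a b c.

Lemma arc_set_arc_point S s m :
  m \is a Num.nat -> \sum_(q in S) a q <= b s * m + c -> X (arc_point S s m).
Proof.
move=> m_nat cap; split => /=.
- by move=> q; rewrite ffunE; case: (q \in S); [right | left].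
- by move=> t; rewrite ffunE; case: ifP.
rewrite /capacity_constraint -subr_le0 opprD addrA; move: cap.
have := flow_form_arc_point a b S s m.
rewrite /flow_form mulrC; under eq_bigr do rewrite mulrC.
by under [X in _ - X = _]eq_bigr do rewrite mulrC; move=> -> ?; lra.
Qed.

Hypotheses (a_gt0 : forall q, 0 < a q) (rho_nat : rho \is a Num.nat).
Hypothesis (rho_feasible : 0 <= b ord0 * rho + c).
Hypothesis (rho_min :
  forall m, m \is a Num.nat -> 0 <= b ord0 * m + c -> rho <= m).
Hypothesis (rho_small : forall q, b ord0 * rho + c < a q).
Hypothesis (b_large : forall t, t != ord0 -> \sum_q a q <= b t + c).
Hypothesis (rho_step : \sum_q a q <= b ord0 * (rho + 1) + c).

Let rho_ge0 : 0 <= rho. Proof. exact: natr_ge0. Qed.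

Lemma arc_set_base : X (arc_point finset.set0 ord0 rho).
Proof. by apply: arc_set_arc_point; rewrite ?big_set0. Qed.

Lemma sum_subset_le S : \sum_(q in S) a q <= \sum_q a q.
Proof. rewrite [leRHS](bigID (mem S)) /= lerDl.
by apply: sumr_ge0 => q _; exact: ltW. Qed.

Lemma arc_set_next S : X (arc_point S ord0 (rho + 1)).
Proof.
apply: arc_set_arc_point; first by rewrite rpredD ?rpred1.
exact: le_trans (sum_subset_le S) rho_step.
Qed.

Lemma arc_set_other S t : t != ord0 -> X (arc_point S t 1).
Proof.
move=> t0; apply: arc_set_arc_point; first exact: rpred1.
by rewrite mulr1; exact: le_trans (sum_subset_le S) (b_large t0).
Qed.

(** If [z >= 1], the terms in [z] alone suffice.  If [z = 0], the constraint
    reads [a . x <= b_1 y_1 + c], so [y_1 >= rho] by minimality of [rho], and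
    [y_1 = rho] leaves no room for any [x_q = 1]. *)
Lemma arc_set_lower_bounds p : X p ->
  let z := \sum_(t | t != ord0) (p.2 t : R) in
  rho <= (p.2 ord0 : R) + rho * z /\
  forall q, (p.1 q : R) + rho <= (p.2 ord0 : R) + (rho + 1) * z.
Proof.
move=> [px py cap] z.
have x0 q : 0 <= (p.1 q : R) by case: (px q) => ->.
have x1 q : (p.1 q : R) <= 1 by case: (px q) => ->.
have y0 t : 0 <= (p.2 t : R) by exact: natr_ge0.
have z_nat : z \is a Num.nat by apply: rpred_sum.
have y00 := y0 ord0.
have [z0|z0] := eqVneq z 0; last first.
  have z1 : 1 <= z.
    by rewrite -[1]add0r natr_lt_addr1 ?rpred0 ?natr_gt0.
  have : 0 <= rho * (z - 1) by rewrite mulr_ge0 ?subr_ge0.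
  by split => [|q]; [|have := x1 q]; lra.
have capE : \sum_q a q * (p.1 q : R) <= b ord0 * (p.2 ord0 : R) + c.
  move: cap; rewrite /capacity_constraint [X in _ <= X + _](bigD1 ord0)//=.
  rewrite [X in _ + X + _]big1 ?addr0// => t t0.
  have /eqP := z0; rewrite psumr_eq0// => /allP/(_ t).
  by rewrite mem_index_enum t0 => /(_ isT)/eqP ->; rewrite mulr0.
rewrite z0 !mulr0 !addr0.
have ax_ge0 i : 0 <= a i * (p.1 i : R) by rewrite mulr_ge0// ltW.
have rho_y : rho <= (p.2 ord0 : R).
  apply: rho_min => //; apply: le_trans capE.
  by apply: sumr_ge0 => i _; exact: ax_ge0.
split => // q; case: (px q) => xq; rewrite xq ?add0r// addrC.
apply: natr_lt_addr1 => //; rewrite lt_neqAle rho_y andbT.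
apply/eqP => rho_eq; have := rho_small q; rewrite rho_eq ltNge => /negP; apply.
by apply: le_trans capE; rewrite (bigD1 q)//= xq mulr1 lerDl sumr_ge0.
Qed.

Let rate k t : R := if t == ord0 then 1 else k.

Lemma arc_set_valid0 p : X p -> flow_form (fun=> 0) (rate rho) p <= - rho.
Proof.
move=> /arc_set_lower_bounds[yp _]; rewrite flow_form_two_rates big1 => [|q _].
  by lra.
by rewrite mulr0.
Qed.

Lemma arc_set_valid1 d p :
  X p -> flow_form (fun q => (q == d)%:R) (rate (rho + 1)) p <= - rho.
Proof.
move=> /arc_set_lower_bounds[_ /(_ d) xyp].
rewrite flow_form_two_rates (bigD1 d)//= eqxx mulr1 big1 => [|q /negPf->].
  by lra.
by rewrite mulr0.
Qed.

(** The box constraints that are tight at [(S, m e_s)] determine every coordinate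
    except the one at [s]; one more tight valid inequality involving that
    coordinate determines the point. *)
Lemma vertex_arc_point alpha beta S s m :
  X (arc_point S s m) -> beta s != 0 ->
  (forall p, X p ->
     flow_form alpha beta p <= flow_form alpha beta (arc_point S s m)) ->
  vertex P (arc_point S s m).
Proof.
move=> Xv bs valid; apply: vertex_conv_hull => // u tight.
have coordx k q p : flow_form (fun i => k *+ (i == q)) (fun=> 0) p =
    (p.1 q : R) * k.
  rewrite /flow_form [X in _ - X]big1 => [|t _]; last by rewrite mulr0.
  rewrite subr0 (bigD1 q)//= eqxx big1 => [|i /negPf->]; last by rewrite mulr0.
  by rewrite addr0.
have coordy t p : flow_form (fun=> 0) (fun i => (i == t)%:R) p = - (p.2 t : R).
  rewrite /flow_form [X in X - _]big1 => [|i _]; last by rewrite mulr0.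
  rewrite (bigD1 t)//= eqxx big1 => [|i /negPf->]; last by rewrite mulr0.
  by rewrite mulr1 addr0 sub0r.
have ux q : u.1 q = (q \in S)%:R :> R.
  have := tight (flow_form (fun i => (if q \in S then 1 else -1) *+ (i == q))
                           (fun=> 0)).
  rewrite /= !coordx /= ffunE; case: (q \in S) => h.
    by move: h; rewrite !mulr1; apply => w [wx _ _]; rewrite coordx mulr1;
      case: (wx q) => ->.
  move: h; rewrite !mulrN1 oppr0 => h.
  apply: oppr_inj; rewrite oppr0; apply: h => w [wx _ _].
  by rewrite coordx mulrN1; case: (wx q) => ->; rewrite ?oppr0 ?lerN10.
have uy t : t != s -> u.2 t = 0 :> R.
  move=> /negPf ts.
  have := tight (flow_form (fun=> 0) (fun i => (i == t)%:R)).
  rewrite /= !coordy /= ffunE ts oppr0 => h.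
  apply: oppr_inj; rewrite oppr0; apply: h => w [_ wy _].
  by rewrite coordy oppr_le0 natr_ge0.
have uE : u = arc_point S s (u.2 s).
  rewrite [LHS]surjective_pairing; congr (_, _); apply/ffunP => i.
    by rewrite ffunE ux.
  by rewrite ffunE; case: eqVneq => [->//|/uy].
have := tight (flow_form alpha beta) valid.
by rewrite /= {1}uE !flow_form_arc_point => /addrI /oppr_inj /(mulIf bs) <-.
Qed.

Lemma vertex_base : vertex P (arc_point finset.set0 ord0 rho).
Proof.
apply: (@vertex_arc_point (fun=> 0) (rate rho)); first exact: arc_set_base.
  exact: oner_neq0.
by move=> p /arc_set_valid0; rewrite flow_form_arc_point big_set0 mulr1 sub0r.
Qed.

Lemma flow_form_indicator q S s m k : q \in S ->
  flow_form (fun i => (i == q)%:R) (rate k) (arc_point S s m) =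
  1 - m * rate k s.
Proof.
move=> qS; rewrite flow_form_arc_point (bigD1 q)//= eqxx big1 ?addr0//.
by move=> i /andP[_ /negPf->].
Qed.

Lemma vertex_next S : S != finset.set0 -> vertex P (arc_point S ord0 (rho + 1)).
Proof.
move=> /set0Pn[q qS].
apply: (@vertex_arc_point (fun i => (i == q)%:R) (rate (rho + 1))).
- exact: arc_set_next.
- exact: oner_neq0.
- move=> p /(arc_set_valid1 q); rewrite flow_form_indicator// /rate eqxx; lra.
Qed.

(** For [S] empty and [rho = 0], the point [(0, e_t)] is the midpoint of [(0, 0)]
    and [(0, 2 e_t)], hence the side condition. *)
Lemma vertex_other S t : t != ord0 -> S != finset.set0 \/ rho != 0 ->
  vertex P (arc_point S t 1).
Proof.
move=> t0; have Xt := arc_set_other S t0.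
have [->|/set0Pn[q qS] _] := eqVneq S finset.set0.
  case=> // rho0; apply: (@vertex_arc_point (fun=> 0) (rate rho)).
  - exact: arc_set_other.
  - by rewrite /rate (negPf t0).
  - move=> p /arc_set_valid0.
    by rewrite flow_form_arc_point big_set0 /rate (negPf t0) mul1r sub0r.
apply: (@vertex_arc_point (fun i => (i == q)%:R) (rate (rho + 1))) => //.
- by rewrite /rate (negPf t0) lt0r_neq0// ltr_wpDl.
- move=> p /(arc_set_valid1 q).
  rewrite flow_form_indicator// /rate (negPf t0); lra.
Qed.

(** The bounds hold for every [S], although not every point involved is a vertex:
    at [(0, (rho + 1) e_1)] and, when [rho = 0], at [(0, e_t)], the bound follows
    from the one at [(0, rho e_1)] because [beta >= 0]. *)
Lemma sep_feasible_bounds alpha beta gamma :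
  sep_feasible P alpha beta gamma ->
  [/\ - rho <= gamma,
      forall S, \sum_(q in S) alpha q <= rho + 1 + gamma
    & forall S t, t != ord0 -> \sum_(q in S) alpha q <= beta t + gamma].
Proof.
move=> [valid beta0 beta_ge0].
have base : - rho <= gamma.
  have := valid _ vertex_base.
  rewrite violationE flow_form_arc_point big_set0 beta0; lra.
split => // [S|S t t0].
  have [->|S0] := eqVneq S finset.set0; first by rewrite big_set0; lra.
  have := valid _ (vertex_next S0).
  rewrite violationE flow_form_arc_point beta0; lra.
have bt := beta_ge0 t t0.
have [[-> rho0]|St] : (S = finset.set0 /\ rho = 0) \/
    (S != finset.set0 \/ rho != 0).
  case: (eqVneq S finset.set0) => [->|]; case: (eqVneq rho 0); auto.
  by rewrite big_set0; move: base; rewrite rho0; lra.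
have := valid _ (vertex_other t0 St).
rewrite violationE flow_form_arc_point; lra.
Qed.

(** The three bounds of [sep_feasible_bounds] with multipliers [1 - u], [u - z]
    and [y_t].  The parameter [u] covers both cases of the theorem. *)
Lemma violation_upper_bound alpha beta gamma p (u : R) :
  let z := \sum_(t | t != ord0) (p.2 t : R) in
  sep_feasible P alpha beta gamma ->
  (forall q, 0 <= (p.1 q : R) <= u) -> (forall t, 0 <= (p.2 t : R)) ->
  z <= u <= 1 ->
  violation alpha beta gamma p <= u + rho - ((p.2 ord0 : R) + (rho + 1) * z).
Proof.
move=> z feas xu y0 /andP[zu u1].
have [gamma_ge next_le other_le] := sep_feasible_bounds feas.
have [_ beta0 _] := feas.
set S := [set q | 0 < alpha q].
set M := \sum_(q in S) alpha q.
have xM : \sum_q (p.1 q : R) * alpha q <= u * M by exact: sum_mul_le_pos_part.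
have yM : z * (M - gamma) <= \sum_(t | t != ord0) (p.2 t : R) * beta t.
  rewrite mulr_suml; apply: ler_sum => t t0.
  by rewrite ler_wpM2l// lerBlDr other_le.
have uM : (u - z) * M <= (u - z) * (rho + 1 + gamma).
  by rewrite ler_wpM2l ?subr_ge0// next_le.
have gM : 0 <= (1 - u) * (gamma + rho).
  by rewrite mulr_ge0 ?subr_ge0// -lerBlDr sub0r.
rewrite /violation [X in _ - X - _](bigD1 ord0)//= beta0.
lra.
Qed.

(** The points [(0, rho e_1)], tight, and [(0, (rho + 1) e_1)], slack, are common
    to both facets.  Their difference is [e_1], so the base point lies in the span
    of the differences and linear span may replace affine span: it is enough
    that [e_1] and the points of [s] generate the unit points. *)
Lemma defines_facet_of_span alpha beta gamma (s : seq (flow_space R Q n)) :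
  beta ord0 = 1 ->
  (forall p, X p -> flow_form alpha beta p <= gamma) -> gamma = - rho ->
  (forall p, p \in s -> X p /\ flow_form alpha beta p = gamma) ->
  size s = (#|Q| + n)%N ->
  (forall V : {vspace flow_space R Q n}, arc_point finset.set0 ord0 1 \in V ->
     (forall p, p \in s -> p \in V) ->
     (forall q, arc_point [set q] ord0 0 \in V) /\
     (forall t, arc_point finset.set0 t 1 \in V)) ->
  defines_facet P alpha beta gamma.
Proof.
move=> beta0 valid gammaE Xs ss span_s.
have PX p : X p -> P p by exact: sub_gen_smallest.
split=> [p Pp|].
  by rewrite ineq_violation violationE subr_le0; exact: conv_hull_le Pp.
exists (#|Q| + n)%N.
have formE m : flow_form alpha beta (arc_point finset.set0 ord0 m) = - m.
  by rewrite flow_form_arc_point big_set0 beta0 mulr1 sub0r.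
refine (@facet_dims R _ P _ (flow_form alpha beta) gamma _
  (arc_point finset.set0 ord0 rho) (arc_point finset.set0 ord0 (rho + 1)) s
  _ _ _ _ _ _ _ _).
- exact: dim_flow_space.
- by move=> x; rewrite tight_flow_form.
- exact: PX (arc_set_next _).
- by rewrite /= formE gammaE; apply/eqP; lra.
- split; first exact: PX arc_set_base.
  by apply/tight_flow_form; rewrite formE.
- by move=> x /Xs[/PX Px fx]; split => //; apply/tight_flow_form.
- exact: ss.
set V := <<_>>%VS.
have eV : arc_point finset.set0 ord0 1 \in V.
  have -> : arc_point finset.set0 ord0 1 =
      arc_point finset.set0 ord0 (rho + 1) - arc_point finset.set0 ord0 rho
      :> flow_space R Q n.
    congr (_, _); apply/ffunP => i; rewrite !ffunE ?inE ?subrr//.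
    by case: ifP; rewrite ?subrr// addrC addKr.
  by apply: memv_span; rewrite mem_head.
have baseV : arc_point finset.set0 ord0 rho \in V.
  have -> : arc_point finset.set0 ord0 rho =
      rho *: arc_point finset.set0 ord0 1 :> flow_space R Q n.
    congr (_, _); apply/ffunP => i; rewrite !ffunE ?inE ?scaler0//.
    by case: ifP; rewrite ?scaler0// /GRing.scale /= mulr1.
  by rewrite rpredZ.
have [|? ?] := span_s V eV; last exact: flow_space_span.
move=> x xs; rewrite -[x](subrK (arc_point finset.set0 ord0 rho)) rpredD//.
apply: memv_span; rewrite inE; apply/orP; right.
by apply/mapP; exists x.
Qed.

(** Besides [(0, rho e_1)], the tight points are the [(0, e_t)] and the
    [({q}, e_t1)], for any one index [t1 != ord0]. *)
Lemma facet_zero t1 :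
  t1 != ord0 -> defines_facet P (fun=> 0) (rate rho) (- rho).
Proof.
move=> t1_neq0.
have rateE t : t != ord0 -> rate rho t = rho by rewrite /rate => /negPf->.
pose s : seq (flow_space R Q n) :=
  [seq arc_point finset.set0 (lift ord0 i) 1 | i <- enum 'I_n] ++
          [seq arc_point [set q] t1 1 | q <- enum Q].
apply: (@defines_facet_of_span _ _ _ s) => //.
- exact: arc_set_valid0.
- move=> p; rewrite mem_cat => /orP[/mapP[i _ ->]|/mapP[q _ ->]].
    split; first exact: arc_set_other.
    by rewrite flow_form_arc_point big_set0 rateE// mul1r sub0r.
  split; first exact: arc_set_other.
  by rewrite flow_form_arc_point big1// rateE// mul1r sub0r.
- by rewrite /s size_cat 2!size_map size_enum_ord addnC cardE.
move=> V V0 sV.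
have Vt t : arc_point finset.set0 t 1 \in V.
  have [i ->|-> //] := unliftP ord0 t.
  apply: sV; rewrite mem_cat; apply/orP; left; apply/mapP.
  by exists i; rewrite ?mem_enum.
split=> // q.
rewrite -(addrK (1 *: arc_point finset.set0 t1 1) (arc_point _ _ _)).
rewrite -arc_point_split rpredB ?rpredZ//.
apply: sV; rewrite mem_cat; apply/orP; right; apply/mapP.
by exists q; rewrite ?mem_enum.
Qed.

(** Besides [(0, rho e_1)], the tight points are the [({d}, e_t)] and the
    [({d, q}, (rho + 1) e_1)]; for [q = d] the latter is [({d}, (rho + 1) e_1)],
    which separates [{d}] from the other coordinates. *)
Lemma facet_single d :
  defines_facet P (fun q => (q == d)%:R) (rate (rho + 1)) (- rho).
Proof.
have rateE t : t != ord0 -> rate (rho + 1) t = rho + 1.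
  by rewrite /rate => /negPf->.
pose s : seq (flow_space R Q n) :=
  [seq arc_point [set d] (lift ord0 i) 1 | i <- enum 'I_n] ++
          [seq arc_point [set d; q] ord0 (rho + 1) | q <- enum Q].
apply: (@defines_facet_of_span _ _ _ s) => //.
- exact: arc_set_valid1.
- move=> p; rewrite mem_cat => /orP[/mapP[i _ ->]|/mapP[q _ ->]].
    split; first exact: arc_set_other.
    by rewrite flow_form_indicator ?set11// rateE//; lra.
  split; first exact: arc_set_next.
  by rewrite flow_form_indicator ?set21// /rate eqxx; lra.
- by rewrite /s size_cat 2!size_map size_enum_ord addnC cardE.
move=> V V0 sV.
have Vpair q : arc_point [set d; q] ord0 0 \in V.
  rewrite -[arc_point _ _ _](addrK ((rho + 1) *: arc_point finset.set0 ord0 1)).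
  rewrite -arc_point_split rpredB ?rpredZ//.
  apply: sV; rewrite mem_cat; apply/orP; right; apply/mapP.
  by exists q; rewrite ?mem_enum.
have Vd : arc_point [set d] ord0 0 \in V.
  by have := Vpair d; rewrite finset.setUid.
split=> [q|t].
  have [->//|qd] := eqVneq q d.
  have -> : arc_point [set q] ord0 0 = arc_point [set d; q] ord0 0 -
      arc_point [set d] ord0 0 :> flow_space R Q n.
    congr (_, _); apply/ffunP => i; rewrite !ffunE ?if_same ?subrr//.
    rewrite !inE; have [->|id] := eqVneq i d; last by rewrite subr0.
    by rewrite eq_sym (negPf qd) subrr.
  by rewrite rpredB.
have [i ->|-> //] := unliftP ord0 t.
rewrite -[arc_point _ _ _]scale1r -(addKr (arc_point [set d] ord0 0) (1 *: _)).
rewrite -arc_point_split addrC rpredB//.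
apply: sV; rewrite mem_cat; apply/orP; left; apply/mapP.
by exists i; rewrite ?mem_enum.
Qed.

End ArcPolytope.

(** * The separation problem *)

Theorem proposition7 (R : realType) (Q : finType) (n : nat)
    (a : Q -> R) (b : 'I_n.+1 -> R) (c : R)
    (hb0 : 0 < b ord0)
    (hb : forall s t : 'I_n.+1, (s <= t)%N -> b s <= b t)
    (ha : forall q, 0 < a q)
    (hac : 0 < \sum_q a q - c)
    (r : int) (hr : r = Num.max (Num.ceil (- c / b ord0)) 0)
    (xbar : {ffun Q -> R^o}) (ybar : {ffun 'I_n.+1 -> R^o})
    (hbar : arc_set_LP a b c (xbar, ybar))
    (hT : (2 <= n.+1)%N)
    (hab : forall q, a q <= b ord0)
    (hra : forall q, b ord0 * r%:~R + c < a q)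
    (hbt : forall t, t != ord0 -> \sum_q a q <= b t + c)
    (hr1 : \sum_q a q <= b ord0 * (r%:~R + 1) + c)
    (hy : \sum_(t | t != ord0) (ybar t : R) < 1) :
  (Q_tilde (xbar, ybar) = finset.set0 ->
     let alpha := fun _ : Q => 0 in
     let beta := fun t : 'I_n.+1 => if t == ord0 then 1 else r%:~R in
     let gamma := - r%:~R in
     solves_separation (arc_poly a b c) (xbar, ybar) alpha beta gamma /\
     defines_facet (arc_poly a b c) alpha beta gamma) /\
  (Q_tilde (xbar, ybar) <> finset.set0 ->
     forall d : Q, (forall q, (xbar q : R) <= (xbar d : R)) ->
     let alpha := fun q : Q => (q == d)%:R in
     let beta := fun t : 'I_n.+1 => if t == ord0 then 1 else r%:~R + 1 in
     let gamma := - r%:~R in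
     solves_separation (arc_poly a b c) (xbar, ybar) alpha beta gamma /\
     defines_facet (arc_poly a b c) alpha beta gamma).
Proof.
set rho : R := r%:~R.
have rho_nat : rho \is a Num.nat.
  rewrite /rho; have : 0 <= r by rewrite hr le_max lexx orbT.
  by case: (r) => // k _; rewrite -pmulrn natr_nat.
have rho_feasible : 0 <= b ord0 * rho + c.
  have : Num.ceil (- c / b ord0) <= r by rewrite hr le_max lexx.
  rewrite ceil_le_int ler_pdivrMr// -/rho; lra.
have rho_min m : m \is a Num.nat -> 0 <= b ord0 * m + c -> rho <= m.
  move=> /natrP[k ->] kc; rewrite pmulrn ler_int hr ge_max le0z_nat andbT.
  rewrite ceil_le_int ler_pdivrMr// -pmulrn; lra.
have rho_ge0 : 0 <= rho by exact: natr_ge0.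
have t1_neq0 : (ord_max : 'I_n.+1) != ord0 by case: (n) hT.
have [xbar01 ybar_ge0 _] := hbar.
set z := \sum_(t | t != ord0) (ybar t : R) in hy.
(* A valid inequality is optimal as soon as it attains the upper bound of
   [violation_upper_bound] for some admissible [u]. *)
have solves alpha k u : 0 <= k ->
    (forall v, arc_set a b c v ->
       flow_form alpha (fun t => if t == ord0 then 1 else k) v <= - rho) ->
    (forall q, (xbar q : R) <= u) -> z <= u <= 1 ->
    violation alpha (fun t => if t == ord0 then 1 else k) (- rho) (xbar, ybar)
      = u + rho - ((ybar ord0 : R) + (rho + 1) * z) ->
    solves_separation (arc_poly a b c) (xbar, ybar) alpha
      (fun t => if t == ord0 then 1 else k) (- rho).
  move=> k0 valid xu zu tight; split.
    split=> [v [Pv _]|//|t /negPf -> //].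
    by rewrite violationE subr_le0; exact: conv_hull_le Pv.
  move=> alpha' beta' gamma' feas; rewrite tight.
  apply: (violation_upper_bound _ _ _ _ _ _ _ feas) => // q.
  by have /andP[-> _] := xbar01 q; rewrite xu.
split=> [Qt0|Qt0 d d_max] alpha beta gamma; split.
- apply: (solves _ _ z) => //.
  + by move=> v; exact: arc_set_valid0.
  + move=> q; have := finset.in_set0 q; rewrite -Qt0 inE => /negbT.
    by rewrite -leNgt.
  + by rewrite lexx ltW.
  + rewrite violationE flow_form_two_rates /= big1 => [|q _]; last exact: mulr0.
    by rewrite -/z; lra.
- exact: facet_zero t1_neq0.
- have zd : z < xbar d.
    have /set0Pn[q] : Q_tilde (xbar, ybar) != finset.set0 by exact/eqP.
    by rewrite inE /= => /lt_le_trans; apply.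
  apply: (solves _ _ (xbar d)) => //.
  + by rewrite addr_ge0.
  + by move=> v; exact: arc_set_valid1.
  + by rewrite ltW//=; have /andP[] := xbar01 d.
  + rewrite violationE flow_form_two_rates /= (bigD1 d)//= /alpha eqxx mulr1.
    rewrite big1 => [|q /negPf->]; last exact: mulr0.
    by rewrite -/z; lra.
- exact: facet_single.
Qed.
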